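(* Let $G$ be a graph of maximum degree $\Delta$, let $\lambda>0$ and let $(\beta_u,\gamma_u)_{u\in V(G)}$ be pairs of positive reals such that the hard-core model on $G$ at fugacity $\lambda$ has local $(\beta_u,\gamma_u)_u$-occupancy. Let $(\ell_u,\eta_u)_{u\in V(G)}$ be pairs of positive reals with $\eta_u<1$ for all $u$, and let $\mathscr H=(L,H)$ be a cover of $G$ that arises from a list-assignment of $G$ and satisfies, for all $u\in V(G)$, \[ \frac{1+\lambda}{\beta_u\lambda}\bigl(|L(u)|-\gamma_u\deg(u)\bigr)\ \ge\ \max\Bigl\{\frac{\ell_u}{1-\eta_u},\ \frac{6\log(2\Delta)}{\eta_u^2}\Bigr\}, \] and $Z_F(\lambda)\ge 8|L(u)|\Delta^3$ for every induced subgraph $F$ of $G[N(u)]$ on more than $\ell_u^*:=\min_{v\in N(u)}\ell_v/8$ vertices. Then $G$ admits an $\mathscr H$-colouring. Moreover, if the hard-core model on $G$ at fugacity $\lambda$ has strong local $(\beta_u,\gamma_u)_u$-occupancy, the same conclusion holds for every cover $\mathscr H$ satisfying these conditions, whether or not it arises from a list-assignment.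
   Context: All graphs are finite and simple; $\log$ is the natural logarithm. For a graph $G$, $\mathcal I(G)$ denotes the set of independent sets (including $\varnothing$), and $Z_G(\lambda)=\sum_{I\in\mathcal I(G)}\lambda^{|I|}$, with $Z_G'$ its derivative in $\lambda$. The hard-core model on $G$ at fugacity $\lambda>0$ is the distribution on $\mathcal I(G)$ with $\Pr(\mathbf I=I)=\lambda^{|I|}/Z_G(\lambda)$. Given $\lambda>0$ and positive reals $(\beta_u,\gamma_u)$ for $u\in V(G)$, the hard-core model on $G$ at fugacity $\lambda$ has local $(\beta_u,\gamma_u)_u$-occupancy if for every $u\in V(G)$ and every induced subgraph $F$ of $G[N(u)]$ (including the graph with no vertices, for which $Z_F=1$, $Z_F'=0$), \[\beta_u\frac{\lambda}{1+\lambda}\frac{1}{Z_F(\lambda)}+\gamma_u\frac{\lambda Z_F'(\lambda)}{Z_F(\lambda)}\ge 1;\] it has strong local $(\beta_u,\gamma_u)_u$-occupancy if this holds for every (not necessarily induced) subgraph $F$ of $G[N(u)]$. A cover of $G$ is a pair $\mathscr H=(L,H)$ where $H$ is a graph and $L:V(G)\to 2^{V(H)}$ is such that: the sets $L(u)$, $u\in V(G)$, partition $V(H)$; each $H[L(u)]$ is complete; if there is an edge of $H$ between $L(u)$ and $L(v)$ with $u\ne v$ then $uv\in E(G)$; and for $uv\in E(G)$ the edges of $H$ between $L(u)$ and $L(v)$ form a (possibly empty) matching. An $\mathscr H$-colouring of $G$ is an independent set of $H$ of size $|V(G)|$. A cover arises from a list-assignment if there are finite sets $S(u)\subset\mathbb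 Z^+$ such that, up to isomorphism, $L(u)=\{(u,c):c\in S(u)\}$ and for $u\neq v$, $(u,c)(v,c')\in E(H)$ iff $uv\in E(G)$ and $c=c'$. *)

(* Defs.v *)
From mathcomp Require Import all_boot.
From Stdlib Require Import Reals.

Set Implicit Arguments.
Unset Strict Implicit.
Unset Printing Implicit Defensive.

Definition simple_graph (T : finType) (e : rel T) : Prop :=
  irreflexive e /\ symmetric e.

Definition nbhd (T : finType) (e : rel T) (u : T) : {set T} := [set v | e u v].

Definition deg (T : finType) (e : rel T) (u : T) : nat := #|nbhd e u|.
Definition maxdeg (T : finType) (e : rel T) : nat := \max_(u : T) deg e u.

Definition indep (T : finType) (f : rel T) (I : {set T}) : bool :=
  [forall x in I, forall y in I, ~~ f x y].

Definition Zpoly (T : finType) (f : rel T) (S : {set T}) (lam : R) : R :=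
  \big[Rplus/0%R]_(I : {set T} | (I \subset S) && indep f I) (lam ^ #|I|)%R.

Definition Zder (T : finType) (f : rel T) (S : {set T}) (lam : R) : R :=
  \big[Rplus/0%R]_(I : {set T} | (I \subset S) && indep f I)
     (INR #|I| * lam ^ (#|I|).-1)%R.

Definition occ_ineq (beta gamma lam Z Zd : R) : Prop :=
  (beta * (lam / (1 + lam)) * (1 / Z) + gamma * (lam * Zd / Z) >= 1)%R.

Definition local_occupancy (T : finType) (e : rel T) (lam : R)
    (beta gamma : T -> R) : Prop :=
  forall (u : T) (S : {set T}), S \subset nbhd e u ->
    occ_ineq (beta u) (gamma u) lam (Zpoly e S lam) (Zder e S lam).

Definition strong_local_occupancy (T : finType) (e : rel T) (lam : R)
    (beta gamma : T -> R) : Prop :=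
  forall (u : T) (S : {set T}) (f : rel T),
    S \subset nbhd e u -> symmetric f -> (forall x y, f x y -> e x y) ->
    occ_ineq (beta u) (gamma u) lam (Zpoly f S lam) (Zder f S lam).

Definition is_cover (T C : finType) (e : rel T) (L : T -> {set C}) (h : rel C)
  : Prop :=
  simple_graph h /\
  (forall c : C, exists u : T, c \in L u) /\
  (forall (c : C) (u v : T), c \in L u -> c \in L v -> u = v) /\
  (forall (u : T) (c1 c2 : C), c1 \in L u -> c2 \in L u -> c1 != c2 -> h c1 c2) /\
  (forall (u v : T) (c1 c2 : C), u != v -> c1 \in L u -> c2 \in L v ->
      h c1 c2 -> e u v) /\
  (forall (u v : T) (c c1 c2 : C), u != v -> c \in L u -> c1 \in L v ->
      c2 \in L v -> h c c1 -> h c c2 -> c1 = c2).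

(* The cover arises from a list-assignment: each vertex of H gets a colour
   col c in Z^+, injective on each L(u) (so L(u) ~ {(u,c) : c in S(u)} with
   S(u) = col(L(u))), and edges between distinct parts are exactly the pairs
   with uv in E(G) and equal colours. *)
Definition from_list (T C : finType) (e : rel T) (L : T -> {set C}) (h : rel C)
  : Prop :=
  exists col : C -> nat,
    (forall c, 0 < col c) /\
    (forall u : T, {in L u &, injective col}) /\
    (forall (u v : T) (c1 c2 : C), u != v -> c1 \in L u -> c2 \in L v ->
        h c1 c2 = e u v && (col c1 == col c2)).

(* The numerical conditions on the cover. The condition
   "|S| > ell*_u := min_{v in N(u)} ell_v / 8" is written as
   "exists v in N(u) with |S| > ell_v / 8" (vacuous when N(u) is empty). *)
Definition cover_conditions (T C : finType) (e : rel T) (Delta : nat) (lam : R)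
    (beta gamma ell eta : T -> R) (L : T -> {set C}) : Prop :=
  forall u : T,
    ((1 + lam) / (beta u * lam) * (INR #|L u| - gamma u * INR (deg e u))
       >= Rmax (ell u / (1 - eta u)) (6 * ln (2 * INR Delta) / (eta u ^ 2)))%R
    /\
    (forall S : {set T}, S \subset nbhd e u ->
       (exists v : T, e u v /\ (INR #|S| > ell v / 8)%R) ->
       (Zpoly e S lam >= 8 * INR #|L u| * INR Delta ^ 3)%R).

Definition colourable (T C : finType) (h : rel C) : Prop :=
  exists I : {set C}, indep h I /\ #|I| = #|T|.

(* Main.v *)
Require Import Defs.
From HB Require Import structures.
From mathcomp Require Import all_boot zify.
From Stdlib Require Import Reals Lra FunctionalExtensionality.

Set Implicit Arguments.
Unset Strict Implicit.
Unset Printing Implicit Defensive.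

(** Weight each independent set I of H by lambda^|I| and view it as a partial
    colouring. Call it bad at an uncoloured u if fewer than ell_u vertices of
    L(u) have no neighbour in I, or if one of these has more than ell_v/8
    neighbours outside L(u) that have no neighbour in I, for some v in N(u).
    Given the partial colouring outside L(N[u]), badness at u has probability
    at most 1/(4 Delta^3), and it is determined by the parts within distance
    two of u, so the lopsided local lemma yields a partial colouring that is
    bad nowhere. Rosenfeld's counting argument then completes it.

    For the first kind of badness let X be the number of available vertices of
    L(u) and let f(s) be the weighted sum of s^X. The indicators of
    availability need not be negatively correlated, but resampling I on the
    neighbourhood of a single c in L(u), under the weights tilted by s^X,
    preserves the occupancy inequality with gamma_u replaced by s gamma_u.
    Summing over c gives f' >= mu f on (0, 1], where mu is the lower bound for
    E X given by the occupancy inequality. Hence f(s) <= exp(-mu (1 - s)) f(1),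
    as for a Poisson variable of mean mu, and Chernoff's bound applies. For the
    second kind, c is available with conditional probability 1/Z_F, where F
    spans the neighbours of c that are not blocked from elsewhere. *)

(** * Finite sums of reals *)

Fact RplusA : associative Rplus. Proof. by move=> x y z; ring. Qed.
Fact RplusC : commutative Rplus. Proof. by move=> x y; ring. Qed.
Fact Rplus0 : left_id 0%R Rplus. Proof. by move=> x; ring. Qed.
Fact Rmul0l : left_zero 0%R Rmult. Proof. by move=> x; ring. Qed.
Fact Rmul0r : right_zero 0%R Rmult. Proof. by move=> x; ring. Qed.
Fact RmulDl : left_distributive Rmult Rplus. Proof. by move=> x y z; ring. Qed.
Fact RmulDr : right_distributive Rmult Rplus. Proof. by move=> x y z; ring. Qed.
HB.instance Definition _ := Monoid.isComLaw.Build R 0%R Rplus RplusA RplusC Rplus0.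
HB.instance Definition _ := Monoid.isMulLaw.Build R 0%R Rmult Rmul0l Rmul0r.
HB.instance Definition _ := Monoid.isAddLaw.Build R Rmult Rplus RmulDl RmulDr.

Notation "\rsum_ ( i | P ) F" := (\big[Rplus/0%R]_(i | P) F%R)
  (at level 41, i at level 0, F at level 41).
Notation "\rsum_ ( i : t | P ) F" := (\big[Rplus/0%R]_(i : t | P) F%R)
  (at level 41, i at level 0, t at level 50, F at level 41, only parsing).
Notation "\rsum_ ( i 'in' A ) F" := (\big[Rplus/0%R]_(i in A) F%R)
  (at level 41, i at level 0, A at level 41, F at level 41).

Definition Rltb (x y : R) : bool := if Rlt_dec x y then true else false.

Lemma RltbP x y : reflect (x < y)%R (Rltb x y).
Proof. by rewrite /Rltb; case: Rlt_dec => h; constructor. Qed.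

Section RealSums.
Variable I : finType.
Implicit Types (P Q : pred I) (F G : I -> R).

Lemma rsum_le P F G : (forall i, P i -> (F i <= G i)%R) ->
  (\rsum_(i | P i) F i <= \rsum_(i | P i) G i)%R.
Proof.
by move=> h; elim/big_ind2: _ => //; [lra | move=> *; lra].
Qed.

Lemma rsum_ge0 P F : (forall i, P i -> (0 <= F i)%R) ->
  (0 <= \rsum_(i | P i) F i)%R.
Proof. by move=> h; elim/big_ind: _ => //; [lra | move=> *; lra]. Qed.

Lemma rsum_split P Q F :
  \rsum_(i | P i) F i =
  (\rsum_(i | P i && Q i) F i + \rsum_(i | P i && ~~ Q i) F i)%R.
Proof. exact: bigID. Qed.

Lemma rsum_le_pred P Q F : (forall i, P i -> Q i) ->
  (forall i, Q i -> (0 <= F i)%R) ->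
  (\rsum_(i | P i) F i <= \rsum_(i | Q i) F i)%R.
Proof.
move=> PQ F0; rewrite (rsum_split Q P).
rewrite [X in (_ <= X + _)%R](eq_bigl P); last first.
  by move=> i; apply/andP/idP => [[]//|Pi]; split=> //; apply: PQ.
suff: (0 <= \rsum_(i | Q i && ~~ P i) F i)%R by lra.
by apply: rsum_ge0 => i /andP[/F0].
Qed.

Lemma rsum_const (A : {set I}) x : \rsum_(i in A) x = (INR #|A| * x)%R.
Proof.
rewrite big_const; elim: #|A| => [|n IH]; first by rewrite /=; ring.
by rewrite iterS IH S_INR; ring.
Qed.

Lemma rsum_distr x P F : (x * \rsum_(i | P i) F i)%R = \rsum_(i | P i) (x * F i).
Proof. exact: big_distrr. Qed.

Lemma INR_sum P (F : I -> nat) : INR (\sum_(i | P i) F i) = \rsum_(i | P i) INR (F i).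
Proof. by apply: (big_morph INR (id1:=0%R)) => // x y; apply: plus_INR. Qed.

Lemma rsum_pos_ex P F : (0 < \rsum_(i | P i) F i)%R -> exists i, P i.
Proof.
move=> h; case: (pickP P) => [i Pi|P0]; first by exists i.
by move: h; rewrite big_pred0 //; lra.
Qed.

Lemma rsum_pos P F i0 : P i0 -> (0 < F i0)%R ->
  (forall i, P i -> (0 <= F i)%R) -> (0 < \rsum_(i | P i) F i)%R.
Proof.
move=> Pi0 F0 Fge; rewrite (bigD1 i0) //=.
have h: (0 <= \rsum_(i | P i && (i != i0)) F i)%R.
  by apply: rsum_ge0 => i /andP[/Fge].
lra.
Qed.

End RealSums.

Lemma rsum_union (I V : finType) (A : {set V}) (P : V -> pred I) (Q : pred I)
    (F : I -> R) :
  (forall i, Q i -> exists2 v, v \in A & P v i) ->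
  (forall v i, P v i -> (0 <= F i)%R) ->
  (\rsum_(i | Q i) F i <= \rsum_(v in A) \rsum_(i | P v i) F i)%R.
Proof.
move=> QP F0.
rewrite (eq_bigr (fun v => \rsum_(i | true) if P v i then F i else 0)%R);
  last by move=> v _; rewrite big_mkcond.
rewrite exchange_big /= big_mkcond; apply: rsum_le => i _.
have ge0 (R' : pred V) : (0 <= \rsum_(v | R' v) (if P v i then F i else 0))%R.
  by apply: rsum_ge0 => v _; case: ifP => [/F0//|]; lra.
case: ifP => [/QP[v vA Pv]|_]; last exact: ge0.
rewrite (bigD1 v) //= Pv.
have := ge0 (fun j => (j \in A) && (j != v)); lra.
Qed.

(** * The local lemma for weighted sums *)

(* The lopsided form: B u need only be rare given the events outside near u,
   not independent of them. *)
Section LocalLemma.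
Variables (V O : finType) (Om : pred O) (w : O -> R) (B : V -> pred O).
Variables (near : V -> {set V}) (p : R).

Definition avoids (S : {set V}) (o : O) := Om o && [forall v in S, ~~ B v o].

Hypothesis w_ge0 : forall o, Om o -> (0 <= w o)%R.
Hypothesis Om_pos : (0 < \rsum_(o | Om o) w o)%R.
Hypothesis p_ge0 : (0 <= p)%R.
Hypothesis p_lt : (2 * p < 1)%R.
Hypothesis p_near : forall u, (4 * p * INR #|near u| <= 1)%R.
Hypothesis p_cond : forall u (S : {set V}), u \notin S -> [disjoint S & near u] ->
  (\rsum_(o | B u o && avoids S o) w o <= p * \rsum_(o | avoids S o) w o)%R.

Lemma avoids_sub (S S' : {set V}) o : S' \subset S -> avoids S o -> avoids S' o.
Proof.
move=> /subsetP sS /andP[oO /forall_inP h]; rewrite /avoids oO.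
by apply/forall_inP => v /sS; apply: h.
Qed.

Lemma avoids_w_ge0 S o : avoids S o -> (0 <= w o)%R.
Proof. by case/andP => /w_ge0. Qed.

(** The events of S outside [near u] cost a factor p by [p_cond]. By induction and a union bound,
    those inside [near u] remove at most a fraction 2p|near u| <= 1/2 of the weight avoiding the
    outside ones, so the factor at most doubles. *)
Lemma local_lemma_cond n u (S : {set V}) : #|S| <= n -> u \notin S ->
  (\rsum_(o | B u o && avoids S o) w o <= 2 * p * \rsum_(o | avoids S o) w o)%R.
Proof.
elim: n u S => [|n IH] u S Sn uS.
  rewrite leqn0 cards_eq0 in Sn.
  have dS: [disjoint S & near u] by rewrite -setI_eq0 (eqP Sn) set0I.
  have := p_cond uS dS.
  have: (0 <= p * \rsum_(o | avoids S o) w o)%R.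
    by apply: Rmult_le_pos => //; apply: rsum_ge0 => o /avoids_w_ge0.
  lra.
set S2 := S :\: near u; set S1 := S :&: near u.
have S2S: S2 \subset S by apply: subsetDl.
have uS2: u \notin S2 by apply: contra uS; apply: (subsetP S2S).
have dS2: [disjoint S2 & near u].
  by rewrite -setI_eq0 /S2 setDE -setIA [_ :&: near u]setIC setICr setI0.
have hB: (\rsum_(o | B u o && avoids S o) w o
          <= \rsum_(o | B u o && avoids S2 o) w o)%R.
  apply: rsum_le_pred => [o /andP[-> /(avoids_sub S2S)]//|o /andP[_]].
  exact: avoids_w_ge0.
have hp := p_cond uS2 dS2.
have h1 : (\rsum_(o | avoids S2 o) w o <= \rsum_(o | avoids S o) w o +
   \rsum_(v in S1) \rsum_(o | B v o && avoids S2 o) w o)%R.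
  rewrite (rsum_split _ (avoids S)).
  apply: Rplus_le_compat.
    by apply: rsum_le_pred => [o /andP[]//|o]; apply: avoids_w_ge0.
  apply: rsum_union => [o /andP[a2 na]|v o /andP[_ /avoids_w_ge0]//].
  move: na; rewrite {1}/avoids; case/andP: (a2) => -> /forall_inP hS2 /=.
  rewrite negb_forall => /existsP[v]; rewrite negb_imply negbK => /andP[vS Bv].
  exists v; last by rewrite Bv.
  rewrite inE vS /=; apply/negPn/negP => nv.
  by have := hS2 v; rewrite inE nv vS Bv => /(_ isT).
have h2 : (\rsum_(v in S1) \rsum_(o | B v o && avoids S2 o) w o <=
   INR #|S1| * (2 * p * \rsum_(o | avoids S2 o) w o))%R.
  rewrite -rsum_const; apply: rsum_le => v; rewrite inE => /andP[vS vn].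
  have vS2 : v \notin S2 by rewrite inE vn.
  apply: IH => //; rewrite -ltnS; apply: leq_trans Sn; apply: proper_card.
  by apply/properP; split=> //; exists v.
have c1 : (INR #|S1| <= INR #|near u|)%R.
  by apply: le_INR; apply/leP; apply: subset_leq_card; apply: subsetIr.
have pn := p_near u.
have W2 : (0 <= \rsum_(o | avoids S2 o) w o)%R.
  by apply: rsum_ge0 => o /avoids_w_ge0.
set x := \rsum_(o | avoids S2 o) w o in h1 h2 W2 hp *.
set y := \rsum_(o | avoids S o) w o in h1 *.
have h3: (INR #|S1| * (2 * p * x) <= / 2 * x)%R.
  have -> : (INR #|S1| * (2 * p * x) = (2 * p * INR #|S1|) * x)%R by ring.
  apply: Rmult_le_compat_r => //.
  have := Rmult_le_compat_l (4 * p) _ _ _ c1; lra.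
have h4 : (x <= 2 * y)%R by lra.
have := Rmult_le_compat_l p _ _ p_ge0 h4; lra.
Qed.

(** Events are added one at a time, and each leaves a fraction of at least 1 - 2p > 0 of the
    weight. *)
Lemma avoids_pos n (S : {set V}) : #|S| = n -> (0 < \rsum_(o | avoids S o) w o)%R.
Proof.
elim: n S => [|n IH] S Sn.
  rewrite (eq_bigl Om) // => o; rewrite /avoids (cards0_eq Sn).
  by case: (Om o) => //=; apply/forall_inP => v; rewrite inE.
have /set0Pn[v vS] : S != set0 by rewrite -cards_eq0 Sn.
have Sv : #|S :\ v| = n by move: Sn; rewrite (cardsD1 v) vS => -[].
have vSv : v \notin S :\ v by rewrite !inE eqxx.
have := local_lemma_cond (leqnn _) vSv; have := IH _ Sv.
rewrite (rsum_split _ (B v)).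
set x := \rsum_(o | avoids (S :\ v) o && ~~ B v o) w o.
have -> : \rsum_(o | avoids S o) w o = x.
  apply: eq_bigl => o; rewrite /avoids -andbA; congr (_ && _).
  apply/forall_inP/andP => [h|[/forall_inP h nB] y yS].
    split; last exact: h.
    by apply/forall_inP => y; rewrite inE => /andP[_ /h].
  by case: (eqVneq y v) => [->//|yv]; apply: h; rewrite !inE yv.
rewrite (eq_bigl (fun o => B v o && avoids (S :\ v) o)); last first.
  by move=> o; rewrite andbC.
set y := \rsum_(o | _) w o => xy le; apply: Rnot_le_lt => x0.
have y0: (0 < x + y)%R by lra.
have := Rmult_lt_compat_r _ _ _ y0 p_lt; lra.
Qed.

Lemma local_lemma : exists o, Om o /\ forall u, ~~ B u o.
Proof.
have /rsum_pos_ex[o /andP[oO /forall_inP h]] := avoids_pos (erefl #|[set: V]|).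
by exists o; split=> // u; apply: h.
Qed.

End LocalLemma.

(** * Lower tails from a differential inequality *)

Section GeneratingFunction.
Variables (I : finType) (P : pred I) (a : I -> R) (n : I -> nat).
Hypothesis a_ge0 : forall i, P i -> (0 <= a i)%R.

Definition genf (s : R) := \rsum_(i | P i) (a i * s ^ n i)%R.
(* Equal to s * genf' s. *)
Definition genf_moment (s : R) := \rsum_(i | P i) (a i * (INR (n i) * s ^ n i))%R.

Lemma genf_derivable s : (0 < s)%R ->
  derivable_pt_lim genf s (/ s * genf_moment s)%R.
Proof.
move=> s0; rewrite /genf_moment rsum_distr /genf.
pose d i x := (a i * x ^ n i)%R.
have -> : (fun x => \rsum_(i | P i) (a i * x ^ n i)%R) =
   (fun x => \big[Rplus/0%R]_(i <- index_enum I) if P i then d i x else 0%R).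
  by apply: functional_extensionality => x;
    rewrite big_mkcond.
rewrite big_mkcond.
elim: (index_enum I) => [|i r IH].
  rewrite big_nil.
  have -> : (fun x : R => \big[Rplus/0%R]_(i <- [::]) (if P i then d i x else 0%R)) =
     fct_cte 0%R.
    by apply: functional_extensionality => x; rewrite big_nil.
  exact: derivable_pt_lim_const.
have -> : (fun x : R => \big[Rplus/0%R]_(j <- i :: r) (if P j then d j x else 0%R)) =
   plus_fct (fun x => if P i then d i x else 0%R)
     (fun x : R => \big[Rplus/0%R]_(j <- r) (if P j then d j x else 0%R)).
  by apply: functional_extensionality => x; rewrite big_cons.
rewrite big_cons; apply: derivable_pt_lim_plus => //.
case: (P i); last exact: derivable_pt_lim_const.
(* When n i = 0 the truncated predecessor is harmless, since the factor [INR (n i)] vanishes. *)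
have -> : (/ s * (a i * (INR (n i) * s ^ n i)) = a i * (INR (n i) * s ^ (n i).-1))%R.
  case: (n i) => [|m] /=; first by ring.
  by field; lra.
exact: (derivable_pt_lim_scal (fun x => x ^ n i)%R) (derivable_pt_lim_pow s (n i)).
Qed.

Variable mu : R.
Hypothesis moment_ge : forall s, (0 < s <= 1)%R ->
  (s * mu * genf s <= genf_moment s)%R.

(** The moment hypothesis says genf' >= mu genf, so genf(x) exp(-mu x) is nondecreasing on [s, 1];
    the mean value theorem compares its end values. *)
Lemma genf_le s : (0 < s <= 1)%R -> (genf s <= exp (- (mu * (1 - s))) * genf 1)%R.
Proof.
move=> [s0 s1]; case: (Req_dec s 1) => [->|sn1].
  have -> : (- (mu * (1 - 1)) = 0)%R by ring.
  by rewrite exp_0; lra.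
pose g x := (genf x * exp (- mu * x))%R.
pose g' x := (/ x * genf_moment x * exp (- mu * x) + genf x * (exp (- mu * x) * - mu))%R.
have dg c : (s <= c <= 1)%R -> derivable_pt_lim g c (g' c).
  move=> hc; apply: derivable_pt_lim_mult; first by apply: genf_derivable; lra.
  apply: (derivable_pt_lim_comp (fun x => - mu * x)%R exp); last exact: derivable_pt_lim_exp.
  have := derivable_pt_lim_scal id (- mu)%R c 1 (derivable_pt_lim_id c).
  by rewrite Rmult_1_r.
have [|c [hc [c1 c2]]] := MVT_cor2 g g' s 1 _ dg; first lra.
have g'0 : (0 <= g' c)%R.
  have -> : (g' c = exp (- mu * c) * (/ c * (genf_moment c - c * mu * genf c)))%R.
    by rewrite /g'; field; lra.
  apply: Rmult_le_pos; first by apply: Rlt_le; apply: exp_pos.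
  apply: Rmult_le_pos; first by apply: Rlt_le; apply: Rinv_0_lt_compat; lra.
  have := @moment_ge c; lra.
have : (g s <= g 1)%R.
  have : (0 <= g' c * (1 - s))%R by apply: Rmult_le_pos => //; lra.
  lra.
rewrite /g => hg.
have -> : (- (mu * (1 - s)) = - mu * 1 + mu * s)%R by ring.
rewrite exp_plus.
have := Rmult_le_compat_r (exp (mu * s)) _ _ (Rlt_le _ _ (exp_pos _)) hg.
rewrite Rmult_assoc -exp_plus.
have -> : (- mu * s + mu * s = 0)%R by ring.
by rewrite exp_0; lra.
Qed.

(** This turns the Chernoff exponent into a quadratic one. The function x ln x - x - (1 - x)^2 / 2
    has derivative ln x + 1 - x <= 0, so its value at s is at least its value -1 at 1. *)
Lemma xlnx_ge s : (0 < s <= 1)%R -> (s - 1 + (1 - s) ^ 2 / 2 <= s * ln s)%R.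
Proof.
move=> [s0 s1]; case: (Req_dec s 1) => [->|sn1]; first by rewrite ln_1; lra.
pose g x := (x * ln x - x - (1 - x) * (1 - x) * / 2)%R.
pose g' x := (ln x + 1 - x)%R.
have dg c : (s <= c <= 1)%R -> derivable_pt_lim g c (g' c).
  move=> hc.
  have d1 : derivable_pt_lim (fun x => 1 - x)%R c (0 - 1)%R.
    by apply: (derivable_pt_lim_minus (fct_cte 1%R) id);
      [apply: derivable_pt_lim_const|apply: derivable_pt_lim_id].
  have -> : g' c = ((1 * ln c + c * / c - 1) -
      (((0 - 1) * (1 - c) + (1 - c) * (0 - 1)) * / 2 + ((1 - c) * (1 - c)) * 0))%R.
    by rewrite /g'; field; lra.
  apply: (derivable_pt_lim_minus (fun x => x * ln x - x)%R (fun x => (1 - x) * (1 - x) * / 2)%R).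
    apply: (derivable_pt_lim_minus (fun x => x * ln x)%R id).
      apply: (derivable_pt_lim_mult id ln); first exact: derivable_pt_lim_id.
      by apply: derivable_pt_lim_ln; lra.
    exact: derivable_pt_lim_id.
  apply: (derivable_pt_lim_mult (fun x => (1 - x) * (1 - x))%R (fct_cte (/ 2))%R).
    exact: (derivable_pt_lim_mult (fun x => 1 - x)%R (fun x => 1 - x)%R).
  exact: derivable_pt_lim_const.
have [|c [hc [c1 c2]]] := MVT_cor2 g g' s 1 _ dg; first lra.
have g'0 : (g' c <= 0)%R.
  have := exp_ineq1_le (ln c); rewrite exp_ln; last lra.
  rewrite /g'; lra.
have : (g' c * (1 - s) <= 0)%R.
  have : (0 <= - g' c * (1 - s))%R by apply: Rmult_le_pos => //; lra.
  lra.
move: hc; rewrite /g ln_1; lra.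
Qed.

(** Chernoff's bound at s = 1 - eta: where n < m <= s mu, the factor s^n is at least s^(s mu), so
    [genf_le] bounds the tail by exp(-mu (1 - s) - s mu ln s) times the total, and [xlnx_ge] bounds
    the exponent. *)
Lemma lower_tail m eta : (0 < eta < 1)%R -> (0 <= mu)%R -> (m <= (1 - eta) * mu)%R ->
  (\rsum_(i | P i && Rltb (INR (n i)) m) a i
     <= exp (- (mu * eta ^ 2 / 2)) * \rsum_(i | P i) a i)%R.
Proof.
move=> heta mu0 hm; set s := (1 - eta)%R.
have hs : (0 < s <= 1)%R by rewrite /s; lra.
have lns : (ln s <= 0)%R.
  by rewrite -ln_1; case: (Req_dec s 1) => [->|?]; [lra|apply: Rlt_le; apply: ln_increasing; lra].
have h1 : (exp (s * mu * ln s) * (\rsum_(i | P i && Rltb (INR (n i)) m) a i) <= genf s)%R.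
  rewrite /genf (rsum_split P (fun i => Rltb (INR (n i)) m)) rsum_distr.
  suff h : (\rsum_(i | P i && Rltb (INR (n i)) m) (exp (s * mu * ln s) * a i)
      <= \rsum_(i | P i && Rltb (INR (n i)) m) (a i * s ^ n i))%R.
    have: (0 <= \rsum_(i | P i && ~~ Rltb (INR (n i)) m) (a i * s ^ n i))%R.
      apply: rsum_ge0 => i /andP[/a_ge0 ai _]; apply: Rmult_le_pos => //.
      by apply: pow_le; lra.
    lra.
  apply: rsum_le => i /andP[/a_ge0 ai /RltbP ni].
  rewrite Rmult_comm; apply: Rmult_le_compat_l => //.
  rewrite -Rpower_pow; last lra.
  rewrite /Rpower.
  have hle : (s * mu * ln s <= INR (n i) * ln s)%R.
    have : (0 <= (s * mu - INR (n i)) * - ln s)%R.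
      by apply: Rmult_le_pos; [rewrite /s; lra|lra].
    lra.
  case: (Req_dec (s * mu * ln s) (INR (n i) * ln s)) => [->|?]; first lra.
  by apply: Rlt_le; apply: exp_increasing; lra.
have h2 := genf_le hs.
have g1 : genf 1 = \rsum_(i | P i) a i.
  by apply: eq_bigr => i _; rewrite pow1 Rmult_1_r.
rewrite g1 in h2.
have sum0 : (0 <= \rsum_(i | P i) a i)%R by apply: rsum_ge0.
set L := \rsum_(i | P i && _) a i in h1 *.
have h3 := Rle_trans _ _ _ h1 h2.
have h4 := Rmult_le_compat_l (exp (- (s * mu * ln s))) _ _ (Rlt_le _ _ (exp_pos _)) h3.
rewrite -!Rmult_assoc -!exp_plus Rplus_opp_l exp_0 Rmult_1_l in h4.
apply: Rle_trans h4 _; apply: Rmult_le_compat_r => //.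
set x := (_ + _)%R; set y := (- _)%R.
suff hxy : (x <= y)%R.
  by case: (Req_dec x y) => [->|?]; [lra|apply: Rlt_le; apply: exp_increasing; lra].
have := Rmult_le_compat_l _ _ _ mu0 (xlnx_ge hs).
rewrite /x /y.
have -> : (1 - s = eta)%R by rewrite /s; ring.
have -> : (s - 1 = - eta)%R by rewrite /s; ring.
lra.
Qed.

End GeneratingFunction.

(** * Resampling a hard-core configuration *)

Section Resampling.
Variables (C : finType) (h : rel C).
Hypothesis h_sym : symmetric h.

Definition free (I : {set C}) : {set C} := [set x | [forall y in I, ~~ h x y]].

Lemma indepP (I : {set C}) :
  reflect (forall x y, x \in I -> y \in I -> ~~ h x y) (indep h I).
Proof.
apply: (iffP forall_inP) => [H x y xI yI|H x xI].
  by have /forall_inP := H x xI; apply.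
by apply/forall_inP => y yI; apply: H.
Qed.

Lemma freeP (I : {set C}) x : reflect (forall y, y \in I -> ~~ h x y) (x \in free I).
Proof. by rewrite inE; apply: forall_inP. Qed.

Lemma indep_sub (I J : {set C}) : J \subset I -> indep h I -> indep h J.
Proof.
by move=> /subsetP JI /indepP H; apply/indepP => x y /JI xI /JI; apply: H.
Qed.

Lemma indep_set0 : indep h set0.
Proof. by apply/indepP => x y; rewrite inE. Qed.

Lemma indep_setU (I J : {set C}) :
  indep h (J :|: I) = [&& indep h J, indep h I & I \subset free J].
Proof.
apply/idP/and3P => [H|[/indepP HJ /indepP HI /subsetP IJ]].
  split; [exact: indep_sub (subsetUl _ _) H|exact: indep_sub (subsetUr _ _) H|].
  apply/subsetP => x xI; apply/freeP => y yJ.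
  by move/indepP: H; apply; rewrite inE ?xI ?yJ ?orbT.
apply/indepP => x y; rewrite !inE => /orP[xJ|xI] /orP[yJ|yI].
- exact: HJ.
- by rewrite h_sym; apply: (freeP _ _ (IJ _ yI)).
- exact: (freeP _ _ (IJ _ xI)).
- exact: HI.
Qed.

(* The spatial Markov property: outside J, the part of the independent set
   inside P is an arbitrary independent subset of the vertices of P that J
   leaves free. *)
Lemma resample (P : {set C}) (Q : pred {set C}) (G : {set C} -> {set C} -> R) :
  (forall I, Q I = Q (I :\: P)) ->
  \rsum_(I | indep h I && Q I) G (I :\: P) (I :&: P) =
  \rsum_(J | [&& indep h J, Q J & J :&: P == set0])
     \rsum_(I : {set C} | (I \subset P :&: free J) && indep h I) G J I.
Proof.
move=> QP.
rewrite (partition_big (fun I => I :\: P)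
   (fun J => [&& indep h J, Q J & J :&: P == set0])) /=; last first.
  move=> I /andP[iI QI]; rewrite -QP QI (indep_sub _ iI) ?subsetDl //=.
  by rewrite setIDAC setDE -setIA setICr setI0.
apply: eq_bigr => J /and3P[iJ QJ /eqP JP].
(* With the outside part J fixed, adding J and intersecting with P are inverse to each other. *)
rewrite (reindex_onto (fun I => J :|: I) (fun I => I :&: P)) /=; last first.
  by move=> I /andP[_ /eqP <-]; rewrite setUC setID.
have eqs (I : {set C}) : I \subset P ->
    ((J :|: I) :\: P = J) * ((J :|: I) :&: P = I).
  move=> IP; split; last by rewrite setIUl JP set0U; apply/setIidPl.
  rewrite setDUl; have /eqP -> : I :\: P == set0 by rewrite setD_eq0.
  by rewrite setU0; apply/setDidPl; rewrite -setI_eq0 JP.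
have eqp (I : {set C}) : (indep h (J :|: I) && Q (J :|: I) && ((J :|: I) :\: P == J) &&
    ((J :|: I) :&: P == I)) = (I \subset P :&: free J) && indep h I.
  rewrite indep_setU iJ /= subsetI.
  case IP: (I \subset P).
    have [e1 e2] := eqs I IP.
    by rewrite QP e1 e2 QJ !eqxx !andbT andbC.
  rewrite (_ : (_ :&: P == I) = false) ?andbF //.
  by apply/negP => /eqP H; move: IP; rewrite -H subsetIr.
rewrite (eq_bigl _ _ eqp).
apply: eq_bigr => I; rewrite subsetI => /andP[/andP[IP _] _].
by have [-> ->] := eqs I IP.
Qed.

Variable lam : R.
Hypothesis lam0 : (0 < lam)%R.

Lemma Zpoly_split (S : {set C}) : Zpoly h S lam =
  (1 + \rsum_(I : {set C} | (I \subset S) && indep h I && (I != set0)) lam ^ #|I|)%R.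
Proof.
rewrite /Zpoly (bigD1 set0) /=; last by rewrite sub0set indep_set0.
by rewrite cards0.
Qed.

Lemma Zpoly_ge1 (S : {set C}) : (1 <= Zpoly h S lam)%R.
Proof.
rewrite Zpoly_split.
suff : (0 <= \rsum_(I : {set C} | (I \subset S) && indep h I && (I != set0)) lam ^ #|I|)%R by lra.
by apply: rsum_ge0 => I _; apply: pow_le; lra.
Qed.

Lemma Zder_lam (S : {set C}) : (lam * Zder h S lam)%R =
  \rsum_(I : {set C} | (I \subset S) && indep h I) (INR #|I| * lam ^ #|I|)%R.
Proof.
rewrite rsum_distr; apply: eq_bigr => I _.
by case: #|I| => [|n] /=; ring.
Qed.

Lemma occ_ineq_clear beta gamma Z Zd : (1 <= Z)%R ->
  occ_ineq beta gamma lam Z Zd ->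
  (Z <= beta * (lam / (1 + lam)) + gamma * (lam * Zd))%R.
Proof.
move=> Z1; rewrite /occ_ineq => H.
have := Rmult_le_compat_l Z _ _ _ (Rge_le _ _ H).
rewrite Rmult_1_r => /(_ ltac:(lra)) /Rle_trans; apply; apply: Req_le.
by field; lra.
Qed.

End Resampling.

(** * Availability of the vertices of a part *)

Section Cover.
Variables (T C : finType) (e : rel T) (h : rel C) (pi : C -> T).
Hypothesis h_sym : symmetric h.
Hypothesis h_clique : forall x y, pi x = pi y -> x != y -> h x y.
Hypothesis h_edge : forall x y, pi x != pi y -> h x y -> e (pi x) (pi y).
Hypothesis h_matching : forall c x y,
  pi c != pi x -> pi x = pi y -> h c x -> h c y -> x = y.

Definition part (u : T) : {set C} := [set c | pi c == u].
Definition nb (c : C) : {set C} := [set x | h c x & pi x != pi c].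
Definition ball1 (u : T) : {set C} := [set x | (pi x == u) || e u (pi x)].

Lemma in_part u c : (c \in part u) = (pi c == u). Proof. by rewrite inE. Qed.

Lemma indep_pi_inj (I : {set C}) : indep h I -> {in I &, injective pi}.
Proof.
move=> /indepP iI x y xI yI pxy; apply/eqP/negPn/negP => nxy.
by have := iI x y xI yI; rewrite h_clique.
Qed.

Lemma nb_sub_ball1 c : nb c \subset ball1 (pi c).
Proof.
apply/subsetP => x; rewrite !inE => /andP[hcx npi].
by rewrite h_edge ?orbT // eq_sym.
Qed.

Lemma mem_free_nb (I : {set C}) c : I :&: part (pi c) = set0 ->
  (c \in free h I) = (I :&: nb c == set0).
Proof.
move=> Iu; apply/freeP/eqP => [H|/setP H y yI].
  apply/setP => x; rewrite !inE; apply/negP => /and3P[xI hcx _].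
  by have := H x xI; rewrite hcx.
apply/negP => hcy; have := H y; rewrite !inE yI hcy /=.
have : y \notin I :&: part (pi c) by rewrite Iu inE.
by rewrite !inE yI /= => ->.
Qed.

(* Two vertices of the same part have no common neighbour outside it. *)
Lemma mem_free_setDnb (I : {set C}) c c' : I :&: part (pi c) = set0 ->
  c' \in part (pi c) -> c' != c ->
  (c' \in free h (I :\: nb c)) = (c' \in free h I).
Proof.
move=> Iu; rewrite in_part => /eqP pc' cc'; apply/freeP/freeP => H y; last first.
  by rewrite inE => /andP[_]; apply: H.
move=> yI; case ync: (y \in nb c); last by apply: H; rewrite inE ync.
apply/negP => hc'y; move: ync; rewrite inE => /andP[hcy npy].
by move/eqP: cc'; apply; apply: (@h_matching y); rewrite ?pc' // h_sym.
Qed.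

(** Double counting: by the matching condition each x in I has at most one neighbour in the part of
    u, and one only if pi x is adjacent to u. The vertices pi x are distinct because parts are
    cliques. *)
Lemma sum_card_nb (I : {set C}) u : indep h I ->
  \sum_(c in part u) #|I :&: nb c| <= deg e u.
Proof.
move=> iI.
have -> : \sum_(c in part u) #|I :&: nb c| =
    \sum_(x in I) \sum_(c in part u) (x \in nb c : nat).
  rewrite exchange_big; apply: eq_bigr => c _.
  by rewrite -sum1_card big_mkcond [RHS]big_mkcond; apply: eq_bigr => x _;
    rewrite in_setI; case: (x \in I); case: (x \in nb c).
apply: (@leq_trans (\sum_(x in I) (e u (pi x) : nat))).
  apply: leq_sum => x xI.
  case: (boolP [exists c in part u, x \in nb c]) => [/existsP[c /andP[cu xc]]|].
    move: (cu); rewrite in_part => /eqP pc.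
    move: (xc); rewrite inE => /andP[hcx npx].
    have -> : e u (pi x) by rewrite -pc h_edge // eq_sym.
    rewrite (bigD1 c cu) xc big1 // => c' /andP[cu' cc'].
    have /eqP pc' : pi c' == u by rewrite -in_part.
    apply/eqP; rewrite eqb0; apply/negP; rewrite inE => /andP[hc'x npx'].
    by move/eqP: cc'; apply; apply: (@h_matching x); rewrite ?pc' -?pc // h_sym.
  rewrite negb_exists => /forallP H; rewrite big1 // => c cu.
  by apply/eqP; rewrite eqb0; have := H c; rewrite cu.
have -> : \sum_(x in I) (e u (pi x) : nat) = #|[set x in I | e u (pi x)]|.
  rewrite -sum1_card big_mkcond [RHS]big_mkcond; apply: eq_bigr => x _.
  by rewrite inE; case: (x \in I); case: (e u (pi x)).
rewrite -(card_in_imset (f := pi)); last first.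
  by move=> x y; rewrite !inE => /andP[xI _] /andP[yI _]; apply: indep_pi_inj iI _ _ xI yI.
apply: subset_leq_card; apply/subsetP => v /imsetP[x]; rewrite !inE => /andP[_ ev] ->.
exact: ev.
Qed.

Variables (lam : R).
Hypothesis lam0 : (0 < lam)%R.
Variables (u : T) (Q : pred {set C}).
Hypothesis QP : forall I, Q I = Q (I :\: ball1 u).

Definition uncoloured (I : {set C}) := I :&: part u == set0.
Definition navail (I : {set C}) : nat := #|part u :&: free h I|.

(** The set [nb c] lies over N[u] and misses the part of u, so resampling on it affects neither
    condition. This is the invariance that [resample] requires. *)
Lemma Quncol_nb c I : c \in part u ->
  (Q I && uncoloured I) = (Q (I :\: nb c) && uncoloured (I :\: nb c)).
Proof.
rewrite in_part => /eqP pc; congr (_ && _).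
  rewrite QP [RHS]QP; congr (Q _).
  by rewrite setDDl; congr (_ :\: _); symmetry; apply/setUidPr; rewrite -pc nb_sub_ball1.
rewrite /uncoloured; congr (_ == _).
apply/setP => x; rewrite !inE; case: eqP => [->|]; rewrite ?andbF // !andbT.
by rewrite pc eqxx andbF.
Qed.

(** The second summand is the availability of c, and the first depends only on I outside [nb c].
    Hence s^X factorises when I is resampled on [nb c]. *)
Lemma navailE c I : c \in part u -> uncoloured I ->
  navail I = #|(part u :\ c) :&: free h (I :\: nb c)| + (I :&: nb c == set0).
Proof.
rewrite /uncoloured in_part => /eqP pc /eqP un.
rewrite /navail (cardsD1 c) addnC in_setI in_part pc eqxx /= -mem_free_nb ?pc //.
congr (_ + _).
apply: eq_card => x; rewrite in_setD1 in_setI [RHS]in_setI in_setD1.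
case: eqP => //= /eqP xc; case xu: (x \in part u) => //=.
by rewrite mem_free_setDnb // pc.
Qed.

Definition wt (I : {set C}) : R := (lam ^ #|I|)%R.

Section OneColour.
Variables (c : C) (b gam s : R).
Hypothesis cu : c \in part u.
Hypothesis s01 : (0 < s <= 1)%R.
Hypothesis occ : forall F : {set C}, F \subset nb c ->
  (Zpoly h F lam <= b + gam * (lam * Zder h F lam))%R.

(* The factor s ^ (I == set0) is the tilt by the availability of c. *)
Lemma one_colour_inner (F : {set C}) : F \subset nb c ->
  (s * (\rsum_(I : {set C} | (I \subset F) && indep h I) (s ^ (I == set0) * wt I))
   <= \rsum_(I : {set C} | (I \subset F) && indep h I)
        (s ^ (I == set0) * wt I * (b * INR (I == set0) + s * gam * INR #|I|)))%R.
Proof.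
move=> /occ Hocc.
have i0 : (set0 \subset F) && indep h set0 by rewrite sub0set indep_set0.
set S1 := \rsum_(I : {set C} | _) _; set S2 := \rsum_(I : {set C} | _) _.
have e1 : S1 = (Zpoly h F lam - 1 + s)%R.
  have aux (x y : R) : x = y -> (s * 1 * 1 + x = 1 + y - 1 + s)%R by move->; ring.
  rewrite /S1 Zpoly_split (bigD1 set0) //= eqxx /wt cards0; apply: aux.
  by apply: eq_bigr => I /andP[_ /negbTE ->] /=; ring.
have e2 : S2 = (s * (b + gam * (lam * Zder h F lam)))%R.
  have aux (x y : R) : x = (s * gam * y)%R ->
      (s * 1 * 1 * (b * 1 + s * gam * 0) + x = s * (b + gam * (0 * 1 + y)))%R.
    by move->; ring.
  rewrite Zder_lam /S2 (bigD1 set0) //= [in RHS](bigD1 set0) //= eqxx /wt cards0.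
  apply: aux; rewrite rsum_distr.
  by apply: eq_bigr => I /andP[_ /negbTE ->] /=; ring.
(* Since s <= 1, Z - 1 + s is at most Z, to which the occupancy inequality applies. *)
rewrite e1 e2; apply: Rmult_le_compat_l; lra.
Qed.

(** With I fixed to J outside [nb c], the rest is an arbitrary independent subset of F, the vertices
    of [nb c] free from J. By [navailE] its tilt is s when it is empty and 1 otherwise, so
    [one_colour_inner] applies to each J. *)
Lemma one_colour :
  (s * (\rsum_(I | indep h I && (Q I && uncoloured I)) (wt I * s ^ navail I))
   <= \rsum_(I | indep h I && (Q I && uncoloured I))
        (wt I * s ^ navail I * (b * INR (c \in free h I) + s * gam * INR #|I :&: nb c|)))%R.
Proof.
pose n J := #|(part u :\ c) :&: free h J|.
have pc : pi c = u by apply/eqP; rewrite -in_part.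
have wtE I : wt I = (wt (I :\: nb c) * wt (I :&: nb c))%R.
  by rewrite /wt -(cardsID (nb c) I) addnC -plusE pow_add.
rewrite (eq_bigr (fun I => (fun J K => wt J * s ^ n J * (s ^ (K == set0) * wt K))%R
    (I :\: nb c) (I :&: nb c))); last first.
  move=> I /and3P[_ _ un]; rewrite (navailE cu un) -plusE pow_add wtE /n; ring.
rewrite [X in (_ <= X)%R](eq_bigr (fun I => (fun J K => wt J * s ^ n J *
    (s ^ (K == set0) * wt K * (b * INR (K == set0) + s * gam * INR #|K|)))%R
    (I :\: nb c) (I :&: nb c))); last first.
  move=> I /and3P[_ _ un]; rewrite (navailE cu un) -plusE pow_add wtE /n mem_free_nb.
    ring.
  by rewrite pc; apply/eqP.
have QPc I := Quncol_nb I cu.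
rewrite (resample h_sym (P := nb c) (Q := fun I => Q I && uncoloured I)
  (fun J K => wt J * s ^ n J * (s ^ (K == set0) * wt K))%R) //.
rewrite (resample h_sym (P := nb c) (Q := fun I => Q I && uncoloured I)
  (fun J K => wt J * s ^ n J *
    (s ^ (K == set0) * wt K * (b * INR (K == set0) + s * gam * INR #|K|)))%R) //.
rewrite rsum_distr; apply: rsum_le => J _.
rewrite -!rsum_distr.
have := one_colour_inner (subsetIl (nb c) (free h J)).
set S1 := \rsum_(I : {set C} | _) _; set S2 := \rsum_(I : {set C} | _) _ => le.
have w0 : (0 <= wt J * s ^ n J)%R.
  by apply: Rmult_le_pos; apply: pow_le; lra.
have := Rmult_le_compat_l _ _ _ w0 le; lra.
Qed.

End OneColour.

Variables (b gam : R).
Hypothesis b0 : (0 < b)%R.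
Hypothesis gam0 : (0 < gam)%R.
Hypothesis occ : forall (c : C) (F : {set C}), c \in part u -> F \subset nb c ->
  (Zpoly h F lam <= b + gam * (lam * Zder h F lam))%R.

(** Summing [one_colour] over the part of u, the availability indicators add up to [navail], and the
    blocking counts to at most deg u by [sum_card_nb]; solving for the moment gives mu. *)
Lemma navail_moment s : (0 < s <= 1)%R ->
  (s * ((INR #|part u| - gam * INR (deg e u)) / b)
     * genf (fun I => indep h I && (Q I && uncoloured I)) wt navail s
   <= genf_moment (fun I => indep h I && (Q I && uncoloured I)) wt navail s)%R.
Proof.
move=> s01; rewrite /genf /genf_moment.
set P := fun I => indep h I && (Q I && uncoloured I).
set f := \rsum_(I | _) _; set g := \rsum_(I | _) _.
have h1 : (INR #|part u| * (s * f) <= b * g + s * gam * INR (deg e u) * f)%R.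
  rewrite -rsum_const.
  apply: (Rle_trans _ (\rsum_(c in part u) \rsum_(I | P I)
     (wt I * s ^ navail I * (b * INR (c \in free h I) + s * gam * INR #|I :&: nb c|)))%R).
    by apply: rsum_le => c cu; apply: one_colour => // F; apply: occ.
  rewrite exchange_big /= /f /g !rsum_distr -big_split /=; apply: rsum_le => I /and3P[iI _ _].
  rewrite -rsum_distr big_split /= -!rsum_distr -!INR_sum.
  have -> : \sum_(c in part u) (c \in free h I : nat) = navail I.
    rewrite /navail -sum1_card big_mkcond [RHS]big_mkcond; apply: eq_bigr => x _.
    by rewrite in_setI; case: (x \in part u); case: (x \in free h I).
  have d : (INR (\sum_(c in part u) #|I :&: nb c|) <= INR (deg e u))%R.
    by apply: le_INR; apply/leP; apply: sum_card_nb.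
  have w0 : (0 <= wt I * s ^ navail I)%R by apply: Rmult_le_pos; apply: pow_le; lra.
  have sg : (0 <= s * gam)%R by apply: Rmult_le_pos; lra.
  have h2 := Rmult_le_compat_l _ _ _ sg d.
  have := Rmult_le_compat_l _ _ _ w0 h2; lra.
apply: (Rmult_le_reg_l b) => //.
have -> : (b * (s * ((INR #|part u| - gam * INR (deg e u)) / b) * f) =
   s * (INR #|part u| - gam * INR (deg e u)) * f)%R by field; lra.
lra.
Qed.

Lemma few_available_le ell eta : (0 < eta < 1)%R -> (0 < ell)%R ->
  (ell / (1 - eta) <= (INR #|part u| - gam * INR (deg e u)) / b)%R ->
  (\rsum_(I | (indep h I && (Q I && uncoloured I)) && Rltb (INR (navail I)) ell) wt I
   <= exp (- ((INR #|part u| - gam * INR (deg e u)) / b * eta ^ 2 / 2))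
      * \rsum_(I | indep h I && Q I) wt I)%R.
Proof.
move=> heta ell0 hmu.
have w0 I : (0 <= wt I)%R by apply: pow_le; lra.
have ell1 : (0 < ell / (1 - eta))%R by apply: Rdiv_lt_0_compat; lra.
apply: Rle_trans (lower_tail (fun I _ => w0 I) navail_moment heta _ _) _; first lra.
  have := Rmult_le_compat_l (1 - eta) _ _ _ hmu.
  have -> : ((1 - eta) * (ell / (1 - eta)) = ell)%R by field; lra.
  by apply; lra.
apply: Rmult_le_compat_l; first by apply: Rlt_le; apply: exp_pos.
by apply: rsum_le_pred => // I /and3P[-> ->].
Qed.

(** Given I outside [nb c], the set F of free vertices in [nb c] is determined. Availability of c
    selects the empty set on F, a share 1/Z_F of the weight, and this is at most q whenever D F
    holds. *)
Lemma many_free_le (c : C) (D : pred {set C}) (q : R) : c \in part u -> (0 <= q)%R ->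
  (forall F : {set C}, F \subset nb c -> D F -> (1 <= q * Zpoly h F lam)%R) ->
  (\rsum_(I | (indep h I && (Q I && uncoloured I)) &&
       ((c \in free h I) && D (nb c :&: free h I))) wt I
   <= q * \rsum_(I | indep h I && Q I) wt I)%R.
Proof.
move=> cu q0 HD.
have pc : pi c = u by apply/eqP; rewrite -in_part.
have w0 I : (0 <= wt I)%R by apply: pow_le; lra.
apply: (Rle_trans _ (q * \rsum_(I | indep h I && (Q I && uncoloured I)) wt I)); last first.
  by apply: Rmult_le_compat_l => //; apply: rsum_le_pred => // I /and3P[-> ->].
rewrite [X in (X <= _)%R](_ : _ = \rsum_(I | indep h I && (Q I && uncoloured I))
   (fun J K => if (K == set0) && D (nb c :&: free h J) then wt J else 0%R)
      (I :\: nb c) (I :&: nb c)); last first.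
  rewrite big_mkcondr; apply: eq_bigr => I /and3P[_ _ /eqP un].
  rewrite mem_free_nb ?pc //; case: eqP => //= e0.
  by have /setDidPl -> : [disjoint I & nb c] by rewrite -setI_eq0 e0.
rewrite [X in (_ <= _ * X)%R](eq_bigr (fun I => (fun J K => wt J * wt K)%R
      (I :\: nb c) (I :&: nb c))); last first.
  by move=> I _; rewrite /wt -(cardsID (nb c) I) addnC -plusE pow_add.
have QPc I := Quncol_nb I cu.
rewrite (resample h_sym (P := nb c) (Q := fun I => Q I && uncoloured I)
   (fun J K => if (K == set0) && D (nb c :&: free h J) then wt J else 0%R)) //.
rewrite (resample h_sym (P := nb c) (Q := fun I => Q I && uncoloured I)
   (fun J K => wt J * wt K)%R) //.
rewrite rsum_distr; apply: rsum_le => J _.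
rewrite -rsum_distr -[\rsum_(I : {set C} | _) wt I]/(Zpoly h (nb c :&: free h J) lam).
rewrite (bigD1 set0) /=; last by rewrite sub0set indep_set0.
rewrite eqxx big1 /=; last by move=> I /andP[_ /negbTE ->].
have Z1 := Zpoly_ge1 h lam0 (nb c :&: free h J).
case: ifP => [/(HD _ (subsetIl _ _)) H|_].
  have := Rmult_le_compat_l _ _ _ (w0 J) H; lra.
have := Rmult_le_pos _ _ (Rmult_le_pos _ _ q0 (w0 J)) (Rle_trans _ _ _ Rle_0_1 Z1); lra.
Qed.

End Cover.

(** * Completing a partial colouring *)

Section Transversals.
Variables (T C : finType) (h : rel C) (pi : C -> T) (M : {set C}).
Hypothesis h_irr : irreflexive h.
Hypothesis h_sym : symmetric h.
Hypothesis h_clique : forall x y, pi x = pi y -> x != y -> h x y.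
Hypothesis M_part : forall u, 0 < #|M :&: part pi u|.
Hypothesis M_nb : forall c c', c \in M -> c' \in M -> h c c' -> pi c != pi c' ->
  8 * #|nb h pi c :&: M| <= #|M :&: part pi (pi c')|.

(** As parts are cliques, independence forces exactly one vertex over each element of S: these are
    the colourings of S from the reduced lists cut out by M. *)
Definition transversals (S : {set T}) : {set {set C}} :=
  [set J : {set C} | [&& J \subset M, indep h J & pi @: J == S]].

(** Deleting c is injective on the sets that contain it. *)
Lemma transversals_del (S : {set T}) c :
  #|[set J in transversals S | c \in J]| <= #|transversals (S :\ pi c)|.
Proof.
rewrite -(card_in_imset (f := fun J : {set C} => J :\ c)); last first.
  move=> J K; rewrite !inE => /andP[_ cJ] /andP[_ cK] eJK.
  by rewrite -(setD1K cJ) eJK setD1K.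
apply: subset_leq_card; apply/subsetP => K /imsetP[J].
rewrite !inE => /andP[/and3P[JM iJ /eqP pJ] cJ] ->.
rewrite (subset_trans (subsetDl _ _) JM) (indep_sub (subsetDl _ _) iJ) /=.
apply/eqP/setP => v; rewrite -pJ; apply/imsetP/setD1P => [[x]|[vc /imsetP[x xJ vx]]].
  rewrite !inE => /andP[xc xJ] ->; split; last exact: imset_f.
  apply/eqP => pxc; move/eqP: xc; apply; exact: (indep_pi_inj h_clique iJ).
exists x => //; rewrite !inE xJ andbT; apply: contra vc => /eqP <-.
by rewrite vx.
Qed.

Lemma transversals_add (S : {set T}) u c : u \notin S -> c \in M :&: part pi u ->
  #|[set J in transversals S | c \in free h J]| <=
  #|[set J in transversals (u |: S) | c \in J]|.
Proof.
move=> uS; rewrite in_setI in_part => /andP[cM /eqP pc].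
have cJ (J : {set C}) : pi @: J = S -> c \notin J.
  by move=> pJ; apply: contra uS => cJ; rewrite -pJ -pc; apply: imset_f.
rewrite -(card_in_imset (f := fun J : {set C} => c |: J)); last first.
  move=> J K; rewrite !inE => /andP[/and3P[_ _ /eqP pJ] _] /andP[/and3P[_ _ /eqP pK] _] eJK.
  by rewrite -(setU1K (cJ J pJ)) eJK setU1K // cJ.
apply: subset_leq_card; apply/subsetP => K /imsetP[J].
rewrite inE => /andP[]; rewrite inE => /and3P[JM iJ /eqP pJ] cf ->.
rewrite inE setU11 andbT inE subUset sub1set cM JM /= imsetU1 pc pJ eqxx andbT.
rewrite setUC indep_setU // iJ sub1set cf andbT.
by apply/indepP => x y; rewrite !inE => /eqP -> /eqP ->; rewrite h_irr.
Qed.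

(* Rosenfeld's counting argument: a uniformly random transversal of S leaves,
   on average, at least half of the vertices of M in part u available. *)
Lemma transversals_grow (S : {set T}) u : u \notin S ->
  #|transversals S| * #|M :&: part pi u| <= 2 * #|transversals (u |: S)|.
Proof.
have [n] := ubnP #|S|; elim: n S u => // n IH S u /ltnSE Sn uS.
set t := #|transversals S|.
have half c : c \in M :&: part pi u ->
    t <= 2 * #|[set J in transversals S | c \in free h J]|.
  move=> cMu; have := cMu; rewrite in_setI in_part => /andP[cM /eqP pc].
  set a := fun c' => #|[set J in transversals S | c' \in J]|.
  set d := #|nb h pi c :&: M|.
  have h1 : t <= #|[set J in transversals S | c \in free h J]| +
       \sum_(c' in nb h pi c :&: M) a c'.
    rewrite /t -(cardsID [set J | c \in free h J] (transversals S)).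
    apply: leq_add; first by apply: subset_leq_card; apply/subsetP => J; rewrite !in_set.
    apply: (@leq_trans #|\bigcup_(c' in nb h pi c :&: M)
                            [set J in transversals S | c' \in J]|).
      apply: subset_leq_card; apply/subsetP => J; rewrite in_setD in_set => /andP[].
      rewrite inE negb_forall => /existsP[y]; rewrite negb_imply negbK => /andP[yJ hcy] JS.
      apply/bigcupP; exists y; last by rewrite inE JS.
      move: JS; rewrite inE => /and3P[/subsetP JM _ /eqP pJ].
      rewrite !inE hcy JM // andbT /= pc; apply: contra uS => /eqP <-.
      by rewrite -pJ; apply: imset_f.
    elim/big_ind2: _ => //; first by rewrite cards0.
    by move=> A x B y hA hB; apply: leq_trans (leq_card_setU _ _) _; apply: leq_add.
  (* By induction, colouring S without pi c' extends in at least half of |M ∩ L(pi c')| >= 8d ways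
     on average, while the transversals through c' inject into those colourings. *)
  have h2 c' : c' \in nb h pi c :&: M -> 8 * d * a c' <= 2 * t.
    rewrite !inE => /andP[/andP[hcc' npc] c'M].
    case: (boolP (pi c' \in S)) => [c'S|c'S]; last first.
      suff -> : a c' = 0 by rewrite muln0.
      apply: eq_card0 => J; rewrite !inE; apply/negP => /andP[/and3P[_ _ /eqP pJ] c'J].
      by move/negP: c'S; apply; rewrite -pJ; apply: imset_f.
    have lt : #|S :\ pi c'| < n.
      by apply: leq_trans Sn; rewrite [X in _ <= X](cardsD1 (pi c')) c'S.
    have := IH _ (pi c') lt; rewrite !inE eqxx => /(_ isT).
    rewrite setD1K // => le1.
    have le2 : 8 * d <= #|M :&: part pi (pi c')| by apply: M_nb => //; rewrite eq_sym.
    have le3 := transversals_del S c'.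
    apply: leq_trans le1; rewrite mulnC; apply: leq_mul => //.
  have h3 : 8 * d * \sum_(c' in nb h pi c :&: M) a c' <= d * (2 * t).
    by rewrite big_distrr /= -sum_nat_const; apply: leq_sum.
  (* For d = 0 there is nothing to divide by, but the sum is empty. Otherwise the union bound loses
     at most t/4, which leaves more than the required half. *)
  case: (posnP d) => [d0|dpos].
    have z : \sum_(c' in nb h pi c :&: M) a c' = 0.
      apply: big1 => c' c'in; move: d0; rewrite /d => /eqP; rewrite cards_eq0 => /eqP e0.
      by rewrite e0 inE in c'in.
    by move: h1; rewrite z addn0; lia.
  have : 4 * \sum_(c' in nb h pi c :&: M) a c' <= t.
    by rewrite -(@leq_pmul2l (2 * d)) ?muln_gt0 ?dpos //; lia.
  by lia.
rewrite mulnC -sum_nat_const.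
apply: (@leq_trans (\sum_(c in M :&: part pi u)
    2 * #|[set J in transversals (u |: S) | c \in J]|)).
  apply: leq_sum => c cMu; apply: leq_trans (half c cMu) _.
  by rewrite leq_mul2l; apply: transversals_add.
rewrite -big_distrr leq_mul2l /=.
(* Double counting: a transversal contains at most one vertex of the part of u. *)
under eq_bigr => c _ do rewrite -sum1dep_card big_mkcondr.
rewrite exchange_big /= -[X in _ <= X]sum1_card; apply: leq_sum => J.
rewrite inE => /and3P[_ iJ _].
rewrite -big_mkcondr sum1dep_card; apply/card_le1_eqP => x y.
rewrite !inE => /andP[/andP[_ /eqP px] xJ] /andP[/andP[_ /eqP py] yJ].
by apply: (indep_pi_inj h_clique iJ) => //; rewrite px.
Qed.

Lemma transversals_pos (S : {set T}) : 0 < #|transversals S|.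
Proof.
have [n] := ubnP #|S|; elim: n S => // n IH S Sn.
have [->|[u uS]] := set_0Vmem S.
  apply/card_gt0P; exists set0.
  by rewrite inE sub0set indep_set0 imset0 eqxx.
have := @transversals_grow (S :\ u) u; rewrite setD11 setD1K // => /(_ isT) H.
have : 0 < #|transversals (S :\ u)|.
  by apply: IH; move: Sn; rewrite (cardsD1 u S) uS.
have := M_part u => p1 p2.
have : 0 < 2 * #|transversals S| by apply: leq_trans H; rewrite muln_gt0 p1 p2.
by rewrite muln_gt0.
Qed.

Lemma transversal_colourable : colourable T h.
Proof.
have /card_gt0P[J] := transversals_pos [set: T].
rewrite inE => /and3P[_ iJ /eqP pJ]; exists J; split=> //.
by rewrite -(card_in_imset (indep_pi_inj h_clique iJ)) pJ cardsT.
Qed.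

End Transversals.

(** * Vertices within distance three *)

Section Near.
Variables (T : finType) (e : rel T).

(** Immediate backtracking is excluded so that the total D + D(D-1) + D(D-1)^2 stays below D^3. *)
Definition near2 (u : T) : {set T} := \bigcup_(a in nbhd e u) (nbhd e a :\ u).
Definition near3 (u : T) : {set T} :=
  \bigcup_(a in nbhd e u) \bigcup_(b in nbhd e a :\ u) (nbhd e b :\ a).
Definition near (u : T) : {set T} := nbhd e u :|: near2 u :|: near3 u.

Lemma card_bigcup_le (I : finType) (A : {set I}) (F : I -> {set T}) n m :
  #|A| <= n -> (forall i, i \in A -> #|F i| <= m) ->
  #|\bigcup_(i in A) F i| <= n * m.
Proof.
move=> An Fm; apply: (@leq_trans (#|A| * m)); last by rewrite leq_mul2r An orbT.
rewrite -sum_nat_const; elim/big_ind2: _ => //; first by rewrite cards0.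
by move=> X x Y y hX hY; apply: leq_trans (leq_card_setU _ _) _; apply: leq_add.
Qed.

Hypothesis e_sym : symmetric e.

Lemma card_near u : #|near u| <= maxdeg e * (maxdeg e * maxdeg e).
Proof.
set D := maxdeg e.
have dD v : #|nbhd e v| <= D by apply: (@leq_bigmax T (deg e) v).
have dD1 v w : e v w -> #|nbhd e w :\ v| <= D.-1.
  move=> vw; have := dD w; rewrite (cardsD1 v) inE e_sym vw.
  by case: D {dD}.
have h2 : #|near2 u| <= D * D.-1.
  by apply: card_bigcup_le => // a; rewrite inE; apply: dD1.
have h3 : #|near3 u| <= D * (D.-1 * D.-1).
  apply: card_bigcup_le => // a; rewrite inE => ua.
  apply: card_bigcup_le; first exact: dD1.
  by move=> b; rewrite !inE => /andP[_]; apply: dD1.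
have h1 := dD u; have h12 := leq_card_setU (nbhd e u) (near2 u).
have h := leq_card_setU (nbhd e u :|: near2 u) (near3 u).
have {h h12} h : #|near u| <= D + D * D.-1 + D * (D.-1 * D.-1).
  by apply: leq_trans h _; apply: leq_add => //; apply: leq_trans h12 _; apply: leq_add.
apply: leq_trans h _; case: D {dD dD1 h1 h2 h3} => [|d]; first by [].
rewrite [_.-1]/= -mulnS -mulnDr leq_mul2l; apply/orP; right; nia.
Qed.

(** The three steps may be lazy, and a walk that backtracks is shortened. One step will account for
    [ball1], the other two for the region that determines badness at v. *)
Lemma near_walk u a b v : (u == a) || e u a -> (a == b) || e a b -> (b == v) || e b v ->
  v = u \/ v \in near u.
Proof.
have two x y z : e x y -> e y z -> z = x \/ z \in near x.
  move=> xy yz; case: (eqVneq z x) => [|zx]; [by left|right].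
  rewrite /near 2!in_setU; apply/orP; left; apply/orP; right.
  by apply/bigcupP; exists y; rewrite !inE ?xy // zx.
have one x y : e x y -> y \in near x by move=> xy; rewrite !inE xy.
case/predU1P => [<-|ua]; case/predU1P => [<-|ab]; case/predU1P => [<-|bv].
- by left.
- by right; apply: one.
- by right; apply: one.
- exact: two ab bv.
- by right; apply: one.
- exact: two ua bv.
- exact: two ua ab.
case: (eqVneq b u) => [eb|bu]; first by right; apply: one; rewrite -eb.
case: (eqVneq v a) => [->|va]; first by right; apply: one.
right; rewrite /near in_setU; apply/orP; right.
apply/bigcupP; exists a; first by rewrite inE.
by apply/bigcupP; exists b; rewrite !inE ?bu ?va.
Qed.

End Near.

(** * Colouring a cover *)

Section Colouring.
Variables (T C : finType) (e : rel T) (h : rel C) (pi : C -> T).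
Hypothesis e_sym : symmetric e.
Hypothesis h_irr : irreflexive h.
Hypothesis h_sym : symmetric h.
Hypothesis h_clique : forall x y, pi x = pi y -> x != y -> h x y.
Hypothesis h_edge : forall x y, pi x != pi y -> h x y -> e (pi x) (pi y).
Hypothesis h_matching : forall c x y,
  pi c != pi x -> pi x = pi y -> h c x -> h c y -> x = y.
Variables (lam : R) (beta gamma ell eta : T -> R).
Hypothesis lam0 : (0 < lam)%R.

(** The 8 is the one in [M_nb]: if u is not crowded and v keeps at least ell_v available vertices,
    its list is at least 8 times as large as the conflict set F. *)
Definition crowded (u : T) (F : {set C}) : bool :=
  [exists v, e u v && Rltb (ell v / 8) (INR #|F|)].

Definition bad (u : T) (I : {set C}) : bool :=
  uncoloured pi u I &&
  (Rltb (INR (navail h pi u I)) (ell u) ||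
   [exists c in part pi u, (c \in free h I) && crowded u (nb h pi c :&: free h I)]).

(** Badness at v tests freeness only of vertices over N[v], which depends on I only within distance
    two of v; beyond [near e u] this region does not meet [ball1 e pi u]. *)
Lemma bad_local u v I : v != u -> v \notin near e u ->
  bad v I = bad v (I :\: ball1 e pi u).
Proof.
move=> vu vn.
have far y b : (pi y == b) || e (pi y) b -> (b == v) || e b v -> y \notin ball1 e pi u.
  move=> yb bv; apply/negP; rewrite inE eq_sym => uy.
  by case: (near_walk uy yb bv) => [/eqP|]; apply/negP.
have frE x : (pi x == v) || e (pi x) v -> (x \in free h (I :\: ball1 e pi u)) = (x \in free h I).
  move=> xv; apply/freeP/freeP => H y; last by rewrite inE => /andP[_]; apply: H.
  move=> yI; apply/negP => hxy.
  have yx : (pi y == pi x) || e (pi y) (pi x).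
    by case: eqVneq => //= npi; apply: h_edge => //; rewrite h_sym.
  by have := H y; rewrite inE yI (far y _ yx xv) hxy => /(_ isT).
rewrite /bad; congr (_ && (_ || _)).
- rewrite /uncoloured; congr (_ == _); apply/setP => y; rewrite 2!in_setI in_part in_setD.
  by case: eqP => [pv|]; rewrite ?andbF // (far y v) ?pv ?eqxx.
- congr (Rltb (INR _) _); apply: eq_card => x; rewrite 2!in_setI in_part.
  by case: eqP => // pv; rewrite frE ?pv ?eqxx.
apply: eq_existsb => c; rewrite in_part; case: eqP => //= pc.
rewrite frE ?pc ?eqxx //; congr (_ && crowded _ _).
apply/setP => x; rewrite 2!in_setI; case xc: (x \in nb h pi c) => //=; rewrite frE //.
move: xc; rewrite inE -pc => /andP[hcx npx].
by rewrite h_edge ?orbT // h_sym.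
Qed.

(** Rosenfeld's argument is run with M = [free h I]. A coloured part keeps its chosen vertex, and an
    edge of M between two parts forces both to be uncoloured, where the absence of badness gives the
    size conditions. *)
Lemma good_colourable (I : {set C}) :
  (forall u, 0 < ell u)%R -> indep h I -> (forall u, ~~ bad u I) -> colourable T h.
Proof.
move=> ell0 iI good.
have If x : x \in I -> x \in free h I.
  by move=> xI; apply/freeP => y yI; move/indepP: iI; apply.
have uncol c c' : c \in free h I -> c' \in free h I -> h c c' -> pi c != pi c' ->
    uncoloured pi (pi c) I.
  move=> /freeP cf /freeP c'f hcc' npi; apply/negPn/negP => /set0Pn[x].
  rewrite in_setI in_part => /andP[xI /eqP px].
  case: (eqVneq x c) => [xc|nxc].
    by have := c'f x xI; rewrite xc h_sym hcc'.
  by have := cf x xI; rewrite h_clique // eq_sym.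
have avail u : uncoloured pi u I -> (ell u <= INR (navail h pi u I))%R.
  move=> un; have := good u; rewrite /bad un /= negb_or => /andP[/RltbP].
  by move/Rnot_lt_le.
apply: (@transversal_colourable _ _ h pi (free h I)) => //.
  move=> u; case: (boolP (uncoloured pi u I)) => [/avail|/set0Pn[x]].
    rewrite /navail setIC => le.
    by apply/ltP; apply: INR_lt; have := ell0 u; rewrite /=; lra.
  rewrite in_setI => /andP[xI xu]; apply/card_gt0P; exists x.
  by rewrite in_setI If.
move=> c c' cf c'f hcc' npi.
have un := uncol c c' cf c'f hcc' npi.
have un' : uncoloured pi (pi c') I by apply: (uncol c' c) => //; [rewrite h_sym|rewrite eq_sym].
have := good (pi c); rewrite /bad un /= negb_or => /andP[_].
rewrite negb_exists => /forallP/(_ c); rewrite in_part eqxx cf /= negb_exists.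
move=> /forallP/(_ (pi c')); rewrite h_edge //= => /RltbP /Rnot_lt_le le1.
have := avail _ un'; rewrite /navail setIC => le2.
by apply/leP; apply: INR_le; rewrite mult_INR /=; lra.
Qed.

Definition bfac (u : T) : R := (beta u * (lam / (1 + lam)))%R.

Hypothesis beta0 : forall u, (0 < beta u)%R.
Hypothesis gamma0 : forall u, (0 < gamma u)%R.
Hypothesis ell_eta : forall u, (0 < ell u /\ 0 < eta u < 1)%R.
Hypothesis occ : forall c (F : {set C}), F \subset nb h pi c ->
  occ_ineq (beta (pi c)) (gamma (pi c)) lam (Zpoly h F lam) (Zder h F lam).
Hypothesis size_part : forall u,
  ((1 + lam) / (beta u * lam) * (INR #|part pi u| - gamma u * INR (deg e u))
   >= Rmax (ell u / (1 - eta u)) (6 * ln (2 * INR (maxdeg e)) / (eta u ^ 2)))%R.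
Hypothesis Zbig : forall c v (F : {set C}), F \subset nb h pi c -> e (pi c) v ->
  (INR #|F| > ell v / 8)%R ->
  (Zpoly h F lam >= 8 * INR #|part pi (pi c)| * INR (maxdeg e) ^ 3)%R.

Lemma bfac_gt0 u : (0 < bfac u)%R.
Proof. by apply: Rmult_lt_0_compat => //; apply: Rdiv_lt_0_compat; lra. Qed.

Lemma size_part_bfac u :
  (Rmax (ell u / (1 - eta u)) (6 * ln (2 * INR (maxdeg e)) / (eta u ^ 2)) <=
   (INR #|part pi u| - gamma u * INR (deg e u)) / bfac u)%R.
Proof.
apply: Rle_trans (Rge_le _ _ (size_part u)) _; apply: Req_le.
by rewrite /bfac; field; have := beta0 u; split; [|split]; lra.
Qed.

Lemma part_gt0 u : 0 < #|part pi u|.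
Proof.
rewrite lt0n; apply/eqP => e0.
have := Rle_trans _ _ _ (Rmax_l _ _) (size_part_bfac u); rewrite e0 /=.
have [l0 et] := ell_eta u.
have h1 : (0 < ell u / (1 - eta u))%R by apply: Rdiv_lt_0_compat; lra.
have h2 : (0 <= gamma u * INR (deg e u) / bfac u)%R.
  apply: Rmult_le_pos; last by apply: Rlt_le; apply: Rinv_0_lt_compat; apply: bfac_gt0.
  by apply: Rmult_le_pos; [apply: Rlt_le|apply: pos_INR].
have -> : ((0 - gamma u * INR (deg e u)) / bfac u = - (gamma u * INR (deg e u) / bfac u))%R.
  by field; have := bfac_gt0 u; lra.
lra.
Qed.

(** The case Delta = 0 is separate because the probability 1/(4 Delta^3) presupposes Delta >= 1.
    Without edges between parts, nonempty lists suffice. *)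
Lemma edgeless_colourable : maxdeg e = 0 -> colourable T h.
Proof.
move=> d0.
have noe u v : e u v = false.
  have := @leq_bigmax T (deg e) u; rewrite -/(maxdeg e) d0 leqn0 cards_eq0.
  by move=> /eqP/setP/(_ v); rewrite !inE.
apply: (@transversal_colourable _ _ h pi setT) => // [u|c c' _ _ hcc' npi].
  by rewrite setTI part_gt0.
by have := h_edge npi hcc'; rewrite noe.
Qed.

Section PositiveDegree.
Hypothesis D0 : 0 < maxdeg e.
Let D3 := (INR (maxdeg e) ^ 3)%R.

Lemma D3_ge1 : (1 <= D3)%R.
Proof. by apply: pow_R1_Rle; apply: (le_INR 1); apply/leP. Qed.

(** The term 6 log(2 Delta) / eta^2 in the size condition makes the exponent at least 3 log(2
    Delta), and (2 Delta)^3 = 8 Delta^3. *)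
Lemma tail_const u :
  (exp (- ((INR #|part pi u| - gamma u * INR (deg e u)) / bfac u * eta u ^ 2 / 2))
    <= / (8 * D3))%R.
Proof.
have := Rle_trans _ _ _ (Rmax_r _ _) (size_part_bfac u).
set mu := (_ / bfac u)%R; have [_ et] := ell_eta u => le.
have e2 : (0 < eta u ^ 2)%R by apply: pow_lt; lra.
have D1 : (1 <= INR (maxdeg e))%R by apply: (le_INR 1); apply/leP.
set x := (2 * INR (maxdeg e))%R in le.
have le2 : (3 * ln x <= mu * eta u ^ 2 / 2)%R.
  have := Rmult_le_compat_r _ _ _ (Rlt_le _ _ e2) le.
  have -> : (6 * ln x / eta u ^ 2 * eta u ^ 2 = 6 * ln x)%R by field; lra.
  lra.
apply: (Rle_trans _ (exp (- (3 * ln x)))).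
  case: (Req_dec (3 * ln x) (mu * eta u ^ 2 / 2)) => [->|?]; first lra.
  by apply: Rlt_le; apply: exp_increasing; lra.
rewrite exp_Ropp; apply: Req_le; congr (/ _)%R.
have -> : (3 * ln x = ln x + ln x + ln x)%R by ring.
by rewrite !exp_plus exp_ln /x /D3; [ring|lra].
Qed.

(** Too few available vertices cost 1/(8 Delta^3). Crowding costs 1/(8 |L(u)| Delta^3) for each c in
    L(u), which a union bound turns into another 1/(8 Delta^3). *)
Lemma bad_le u (Q : pred {set C}) : (forall I, Q I = Q (I :\: ball1 e pi u)) ->
  (\rsum_(I | bad u I && (indep h I && Q I)) wt lam I
   <= / (4 * D3) * \rsum_(I | indep h I && Q I) wt lam I)%R.
Proof.
move=> QP.
set W := \rsum_(I | indep h I && Q I) _.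
set P := fun I => indep h I && (Q I && uncoloured pi u I).
have w0 I : (0 <= wt lam I)%R by apply: pow_le; lra.
have W0 : (0 <= W)%R by apply: rsum_ge0.
have D1 := D3_ge1.
have occu c (F : {set C}) : c \in part pi u -> F \subset nb h pi c ->
    (Zpoly h F lam <= bfac u + gamma u * (lam * Zder h F lam))%R.
  rewrite in_part => /eqP <- /occ; apply: occ_ineq_clear => //.
  exact: Zpoly_ge1.
have [l0 et] := ell_eta u.
have h1 := few_available_le h_sym h_clique h_edge h_matching lam0 QP (bfac_gt0 u) (gamma0 u)
   occu et l0 (Rle_trans _ _ _ (Rmax_l _ _) (size_part_bfac u)).
have {}h1 := Rle_trans _ _ _ h1 (Rmult_le_compat_r _ _ _ W0 (tail_const u)).
set k := INR #|part pi u|.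
have k1 : (1 <= k)%R by apply: (le_INR 1); apply/leP; apply: part_gt0.
have kD : (0 < 8 * k * D3)%R by apply: Rmult_lt_0_compat; lra.
have h2 c : c \in part pi u ->
   (\rsum_(I | P I && ((c \in free h I) && crowded u (nb h pi c :&: free h I))) wt lam I
    <= / (8 * k * D3) * W)%R.
  move=> cu; apply: (many_free_le h_sym h_edge lam0 QP cu).
    by apply: Rlt_le; apply: Rinv_0_lt_compat.
  move=> F Fnb /existsP[v /andP[uv /RltbP Fv]].
  have pc : pi c = u by apply/eqP; rewrite -in_part.
  have := @Zbig c v F Fnb; rewrite pc -/k -/D3 => /(_ uv Fv) /Rge_le H.
  apply: (Rmult_le_reg_l (8 * k * D3)) => //.
  by rewrite -Rmult_assoc Rinv_r; lra.
apply: (Rle_trans _ (\rsum_(I | P I && Rltb (INR (navail h pi u I)) (ell u)) wt lam I +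
  \rsum_(c in part pi u)
    \rsum_(I | P I && ((c \in free h I) && crowded u (nb h pi c :&: free h I))) wt lam I)%R).
  rewrite (rsum_split _ (fun I => Rltb (INR (navail h pi u I)) (ell u))).
  apply: Rplus_le_compat.
    apply: rsum_le_pred => // I; rewrite /P.
    by case/andP=> /andP[/andP[-> _] /andP[-> ->]] ->.
  apply: rsum_union => // I.
  case/andP=> /andP[/andP[un +] /andP[iI QI]] nlt.
  rewrite (negbTE nlt) /= => /existsP[c /andP[cu cf]].
  by exists c => //; rewrite /P iI QI un cf.
have h3 : (\rsum_(c in part pi u)
    \rsum_(I | P I && ((c \in free h I) && crowded u (nb h pi c :&: free h I))) wt lam I
    <= / (8 * D3) * W)%R.
  apply: Rle_trans (rsum_le h2) _; rewrite rsum_const -/k; apply: Req_le.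
  by field; lra.
have -> : (/ (4 * D3) * W = / (8 * D3) * W + / (8 * D3) * W)%R by field; lra.
exact: Rplus_le_compat.
Qed.

Lemma positive_degree_colourable : colourable T h.
Proof.
have D1 := D3_ge1.
have w0 I : (0 <= wt lam I)%R by apply: pow_le; lra.
have p0 : (0 < / (4 * D3))%R by apply: Rinv_0_lt_compat; lra.
have p1 : (/ (4 * D3) <= / 4)%R by apply: Rinv_le_contravar; lra.
suff [I [iI good]] : exists I, indep h I /\ forall u, ~~ bad u I.
  by apply: good_colourable iI good => u; have [] := ell_eta u.
(* With p = 1/(4 Delta^3), the bound |near u| <= Delta^3 gives exactly 4p|near u| <= 1. *)
apply: (local_lemma (w := wt lam) (near := near e) (p := (/ (4 * D3))%R)) => //.
- by apply: (rsum_pos (i0 := set0)) => //; [apply: indep_set0|rewrite /wt cards0 /=; lra].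
- exact: Rlt_le.
- lra.
- move=> u; have := le_INR _ _ (leP (card_near e_sym u)); rewrite !mult_INR => le.
  have le' : (INR #|near e u| <= D3)%R by rewrite /D3 /=; lra.
  have := Rmult_le_compat_l _ _ _ (Rlt_le _ _ p0) le'.
  have -> : (/ (4 * D3) * D3 = / 4)%R by field; lra.
  lra.
(* Every v in S differs from u and lies outside [near e u], so avoiding S is determined outside
   [ball1 e pi u]. *)
move=> u S uS dS; apply: (@bad_le u (fun I => [forall v in S, ~~ bad v I])) => I.
apply: eq_forallb => v; case vS: (v \in S) => //=; congr (~~ _).
apply: bad_local; first by apply: contraNneq uS => <-.
by move/disjointFr: dS => ->.
Qed.

End PositiveDegree.

Lemma occupancy_colourable : colourable T h.
Proof.
case: (posnP (maxdeg e)) => [/edgeless_colourable //|].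
exact: positive_degree_colourable.
Qed.

End Colouring.

(** * Moving partition functions from H to G *)

Section Transfer.
Variables (T C : finType) (h : rel C) (f : rel T) (pi : C -> T) (F : {set C}).
Hypothesis pi_inj : {in F &, injective pi}.
Hypothesis f_pi : {in F &, forall x y, f (pi x) (pi y) = h x y}.

(** On F the map [pi] is an isomorphism onto its image, so it matches independent sets of equal
    size. The weight g stays general to serve both Z and its derivative. *)
Lemma sum_indep_imset (g : nat -> R) :
  \rsum_(I : {set C} | (I \subset F) && indep h I) g #|I| =
  \rsum_(J : {set T} | (J \subset pi @: F) && indep f J) g #|J|.
Proof.
have memI (I : {set C}) x : I \subset F -> x \in F -> (pi x \in pi @: I) = (x \in I).
  move=> /subsetP IF xF; apply/imsetP/idP => [[y yI pxy]|xI]; last by exists x.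
  by rewrite (pi_inj xF (IF y yI) pxy).
rewrite [RHS](reindex_onto (fun I : {set C} => pi @: I) (fun J => F :&: pi @^-1: J)); last first.
  move=> J /andP[/subsetP JF _]; apply/setP => v; apply/imsetP/idP => [[x]|vJ].
    by rewrite !inE => /andP[_ ?] ->.
  have /imsetP[x xF vx] := JF v vJ.
  by exists x => //; rewrite !inE xF -vx.
apply: eq_big => [I|I /andP[/subsetP IF _]]; last first.
  by rewrite card_in_imset // => x y /IF xF /IF yF; apply: pi_inj.
case IF: (I \subset F) => /=; last first.
  by apply/esym/negP => /andP[_ /eqP H]; move: IF; rewrite -H subsetIl.
rewrite imsetS //= [X in _ && X](_ : _ = true) ?andbT; last first.
  apply/eqP/setP => x; rewrite !inE; case xF: (x \in F) => /=; first exact: memI.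
  by apply/esym/negP => /(subsetP IF); rewrite xF.
apply/indepP/indepP => H x y.
  move=> /imsetP[x' x'I ->] /imsetP[y' y'I ->].
  by rewrite f_pi ?(subsetP IF) //; apply: H.
move=> xI yI; rewrite -f_pi ?(subsetP IF) //; apply: H; exact: imset_f.
Qed.

Lemma Zpoly_imset lam : Zpoly h F lam = Zpoly f (pi @: F) lam.
Proof. exact: (sum_indep_imset (fun n => lam ^ n)%R). Qed.

Lemma Zder_imset lam : Zder h F lam = Zder f (pi @: F) lam.
Proof. exact: (sum_indep_imset (fun n => INR n * lam ^ n.-1)%R). Qed.

End Transfer.

(** Fewer edges leave more independent sets. This passes the lower bound on Z from induced subgraphs
    of G to the possibly sparser copy of H[F]. *)
Lemma Zpoly_subrel (T : finType) (f e : rel T) (S : {set T}) lam :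
  (0 < lam)%R -> subrel f e -> (Zpoly e S lam <= Zpoly f S lam)%R.
Proof.
move=> lam0 fe; apply: rsum_le_pred => [I /andP[-> /indepP iI]|I _].
  by apply/indepP => x y xI yI; apply: contra (iI x y xI yI); apply: fe.
by apply: pow_le; lra.
Qed.

(** * From covers to colourings *)

Section Covers.
Variables (T C : finType) (e : rel T) (L : T -> {set C}) (h : rel C).
Variables (lam : R) (beta gamma ell eta : T -> R).
Hypothesis e_simple : simple_graph e.
Hypothesis lam0 : (0 < lam)%R.
Hypothesis beta_gamma : forall u, (0 < beta u /\ 0 < gamma u)%R.
Hypothesis ell_eta : forall u, (0 < ell u /\ 0 < eta u < 1)%R.
Hypothesis cover : is_cover e L h.
Hypothesis conditions : cover_conditions e (maxdeg e) lam beta gamma ell eta L.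

(* The hypothesis asks to realise H[F], for F made of neighbours of a single
   vertex c, as a subgraph f of G to which local occupancy applies: f is e
   itself for a list-assignment, and a possibly sparser graph in general. *)
Lemma cover_colourable :
  (forall u c (F : {set C}), c \in L u ->
     (forall x, x \in F -> h c x /\ x \notin L u) ->
     exists f : rel T, [/\ subrel f e,
       (forall S : {set T}, S \subset nbhd e u ->
          occ_ineq (beta u) (gamma u) lam (Zpoly f S lam) (Zder f S lam)) &
       forall x y v w, x \in F -> y \in F -> x \in L v -> y \in L w ->
         f v w = h x y]) ->
  colourable T h.
Proof.
case: cover => [[h_irr h_sym] [cov [uniqL [clique [edge matching]]]]] real.
have cov' c : exists u, c \in L u by exact: cov.
(* The choice is forced, since each vertex of H lies in exactly one L(u). *)
pose pi c := xchoose (cov' c).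
have piL c : c \in L (pi c) by exact: (xchooseP (cov' c)).
have Lpi c u : c \in L u -> pi c = u by move=> cu; apply: uniqL (piL c) cu.
have partE u : part pi u = L u.
  by apply/setP => c; rewrite inE; apply/eqP/idP => [<-|/Lpi].
have h_edge x y : pi x != pi y -> h x y -> e (pi x) (pi y).
  by move=> npi; apply: edge.
have h_match c x y : pi c != pi x -> pi x = pi y -> h c x -> h c y -> x = y.
  by move=> npi pxy; apply: (matching (pi c) (pi x)) => //; rewrite pxy.
have nb_inj c (F : {set C}) : F \subset nb h pi c -> {in F &, injective pi}.
  move=> /subsetP Fc x y /Fc + /Fc; rewrite !inE => /andP[hcx npx] /andP[hcy _] pxy.
  by apply: (h_match c) => //; rewrite eq_sym.
have nb_img c (F : {set C}) : F \subset nb h pi c -> pi @: F \subset nbhd e (pi c).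
  move=> /subsetP Fc; apply/subsetP => v /imsetP[x /Fc + ->]; rewrite !inE.
  by case/andP=> hcx npx; apply: h_edge; rewrite // eq_sym.
have real' c (F : {set C}) : F \subset nb h pi c -> exists f : rel T, [/\ subrel f e,
       (forall S : {set T}, S \subset nbhd e (pi c) ->
          occ_ineq (beta (pi c)) (gamma (pi c)) lam (Zpoly f S lam) (Zder f S lam)) &
       {in F &, forall x y, f (pi x) (pi y) = h x y}].
  move=> /subsetP Fc; have [|f [fe occ fh]] := real (pi c) c F (piL c).
    move=> x /Fc; rewrite inE => /andP[hcx npx]; split=> //.
    by apply: contra npx => /Lpi ->.
  by exists f; split=> // x y xF yF; apply: fh.
have [e_irr e_sym] := e_simple.
apply: (@occupancy_colourable T C e h pi e_sym h_irr h_sym _ h_edge h_match lam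
   beta gamma ell eta lam0) => // [x y pxy nxy|u|u|c F Fc|u|c v F Fc cv Fv].
- by apply: (clique (pi x)) => //; rewrite pxy.
- by have [] := beta_gamma u.
- by have [] := beta_gamma u.
- have [f [_ occ fh]] := real' c F Fc.
  rewrite (Zpoly_imset (nb_inj c F Fc) fh) (Zder_imset (nb_inj c F Fc) fh).
  exact: occ (nb_img c F Fc).
- by rewrite partE; have [] := conditions u.
have [f [fe _ fh]] := real' c F Fc.
rewrite (Zpoly_imset (nb_inj c F Fc) fh) partE.
have [_ big] := conditions (pi c).
have := big (pi @: F) (nb_img c F Fc); rewrite (card_in_imset (nb_inj c F Fc)).
move=> /(_ (ex_intro _ v (conj cv Fv))) /Rge_le le.
by apply: Rle_ge; apply: Rle_trans le _; apply: Zpoly_subrel.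
Qed.

End Covers.

Theorem mainTheorem3 (T : finType) (e : rel T) (Delta : nat) (lam : R)
    (beta gamma : T -> R) :
  simple_graph e ->
  Delta = maxdeg e ->
  (0 < lam)%R ->
  (forall u, 0 < beta u /\ 0 < gamma u)%R ->
  (local_occupancy e lam beta gamma ->
     forall ell eta : T -> R,
       (forall u, 0 < ell u /\ 0 < eta u < 1)%R ->
       forall (C : finType) (L : T -> {set C}) (h : rel C),
         is_cover e L h -> from_list e L h ->
         cover_conditions e Delta lam beta gamma ell eta L ->
         colourable T h)
  /\
  (strong_local_occupancy e lam beta gamma ->
     forall ell eta : T -> R,
       (forall u, 0 < ell u /\ 0 < eta u < 1)%R ->
       forall (C : finType) (L : T -> {set C}) (h : rel C),
         is_cover e L h ->
         cover_conditions e Delta lam beta gamma ell eta L ->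
         colourable T h).
Proof.
move=> se -> lam0 bg; have [e_irr e_sym] := se.
split=> occ ell eta le C L h cov.
  move=> [col [_ [col_inj col_h]]] cond.
  have [[h_irr _] _] := cov.
  apply: (cover_colourable se lam0 bg le cov cond) => u c F cu Fc.
  (* All vertices of F share the colour of c, so over distinct vertices of G they are adjacent
     exactly when these are. Over the same vertex they coincide. *)
  exists e; split=> // [S|x y v w xF yF xv yw]; first exact: occ.
  have [hcx xu] := Fc x xF; have [hcy yu] := Fc y yF.
  have ne z t : z \in L t -> z \notin L u -> u != t.
    by move=> zt; apply: contra => /eqP ->.
  have := col_h u v c x (ne _ _ xv xu) cu xv; rewrite hcx => /esym/andP[_ /eqP cx].
  have := col_h u w c y (ne _ _ yw yu) cu yw; rewrite hcy => /esym/andP[_ /eqP cy].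
  case: (eqVneq v w) => [vw|nvw]; last by rewrite (col_h v w) // -cx -cy eqxx andbT.
  have -> : x = y by apply: (col_inj v); rewrite ?vw // -?vw // -cx.
  by rewrite vw e_irr h_irr.
move=> cond.
have [[h_irr h_sym] [_ [_ [_ [edge matching]]]]] := cov.
apply: (cover_colourable se lam0 bg le cov cond) => u c F cu Fc.
have Finj x y v : x \in F -> y \in F -> x \in L v -> y \in L v -> x = y.
  move=> xF yF xv yv; have [hcx xu] := Fc x xF; have [hcy _] := Fc y yF.
  by apply: (matching u v c) => //; apply: contra xu => /eqP ->.
(* The edges of H[F] are projected to G. By [Finj] each vertex of G has at most one preimage in F,
   so f is a faithful copy; it need not be induced, hence strong occupancy. *)
pose f (v w : T) := (v != w) && [exists x in F, exists y in F, [&& x \in L v, y \in L w & h x y]].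
have fP v w : reflect
    (v != w /\ exists x y, [/\ x \in F, y \in F, x \in L v, y \in L w & h x y]) (f v w).
  apply: (iffP andP) => -[nvw H]; split=> //.
    case/existsP: H => x /andP[xF /existsP[y /andP[yF /and3P[xv yw hxy]]]].
    by exists x, y.
  case: H => x [y [xF yF xv yw hxy]].
  by apply/existsP; exists x; rewrite xF; apply/existsP; exists y; rewrite yF xv yw.
exists f; split.
- by move=> v w /fP[nvw [x [y [xF yF xv yw]]]]; apply: edge.
- move=> S Su; apply: occ => //.
    move=> v w; apply/fP/fP => -[nvw [x [y [xF yF xv yw hxy]]]];
      by split; [rewrite eq_sym|exists y, x; split=> //; rewrite h_sym].
  by move=> v w /fP[nvw [x [y [xF yF xv yw]]]]; apply: edge.
move=> x y v w xF yF xv yw; apply/fP/idP => [[_ [x' [y' [x'F y'F x'v y'w]]]]|hxy].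
  by rewrite (Finj x' x v) // (Finj y' y w).
split; last by exists x, y.
apply/eqP => vw; have exy : x = y by apply: (Finj x y v); rewrite // vw.
by move: hxy; rewrite exy h_irr.
Qed.
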